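(* Let $C$ be a projective $[n,k]_q$ code and consider integers $l,r$ such that $1\le l\le k$ and $1\le r\le\begin{bmatrix}k\\l\end{bmatrix}_q$. If $n>\begin{bmatrix}k\\l\end{bmatrix}_q-\alpha_q^l(k,r)$, then $M^l(C)>\begin{bmatrix}k\\l\end{bmatrix}_q-r$.
   Context: $\mathbb{F}_q$ is the finite field with $q$ elements, $q$ a power of a prime. An $[n,k]_q$ linear code $C$ is a $k$-dimensional subspace of $\mathbb{F}_q^n$; all codes are assumed to be non-trivial ($k\ge 1$) and to have effective length $n$, i.e. every coordinate position is non-zero in some codeword. $PG(\mathbb{F}_q^k)$ is the projective space whose points are the 1-dimensional subspaces of $\mathbb{F}_q^k$. Given a generator matrix $G$ of $C$ (a $k\times n$ matrix whose rows form a basis of $C$) with columns $G_1,\dots,G_n$, the code $C$ is called projective if no column is zero and the points $\langle G_1\rangle,\dots,\langle G_n\rangle$ of $PG(\mathbb{F}_q^k)$ are pairwise distinct. For a subcode (linear subspace) $D\le C$, $\operatorname{supp}(D)=\{i\in\{1,\dots,n\} : \exists\, v\in D \text{ with } v_i\neq 0\}$. An $l$-dimensional subcode $D$ of $C$ is called support-minimal if there is no other $l$-dimensional subcode $D'\le C$ such that $\operatorname{supp}(D')\subset\operatorname{supp}(D)$ (proper inclusion). For $1\le l\le k$, $M^l(C)$ denotes the number of support-minimal $l$-dimensional subcodes of $C$. $\begin{bmatrix}k\\l\end{bmatrix}_q=\frac{(q^k-1)(q^{k-1}-1)\cdots(q^{k-l+1}-1)}{(q^l-1)(q^{l-1}-1)\cdots(q-1)}$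 is the Gaussian binomial coefficient, which gives the number of subspaces of $\mathbb{F}_q^k$ of co-dimension $l$. For $1\le l\le k$ and $1\le r\le\begin{bmatrix}k\\l\end{bmatrix}_q$, $\alpha_q^l(k,r)$ denotes the minimum cardinality of a point set $\mathcal{S}\subseteq PG(\mathbb{F}_q^k)$ such that there exist $r$ distinct subspaces $W_1,\dots,W_r$ of co-dimension $l$ and $r$ subspaces $U_1,\dots,U_r$ of co-dimension $l+1$ with $U_i\le W_i$ for all $1\le i\le r$ and $\bigcup_{i=1}^r (W_i\setminus U_i)\subseteq\mathcal{S}$, where $W_i\setminus U_i$ is the set of points contained in $W_i$ but not in $U_i$. *)

(* Defs.v *)
From HB Require Import structures.
From mathcomp Require Import all_boot all_algebra.

Set Implicit Arguments.
Unset Strict Implicit.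
Unset Printing Implicit Defensive.

(* Over a finite field, subspaces form a finite type, through their encoding  *)
(* by row-reduced matrices.                                                   *)
HB.instance Definition _ (F : finFieldType) (vT : vectType F) :=
  CanIsCountable (@VectorInternalTheory.vs2mxK F vT).
HB.instance Definition _ (F : finFieldType) (vT : vectType F) :
    isFinite {vspace vT} :=
  CanIsFinite (@VectorInternalTheory.vs2mxK F vT).

(* The division is exact when l <= k. *)
Definition gauss_binomial (q k l : nat) : nat :=
  (\prod_(i < l) (q ^ (k - i) - 1)) %/ (\prod_(i < l) (q ^ (l - i) - 1)).

Section Codes.

Variables (F : finFieldType) (n : nat).
Implicit Types C D : {vspace 'rV[F]_n}.

Definition supp D : {set 'I_n} :=
  [set i : 'I_n | [exists v : 'rV[F]_n, (v \in D) && (v ord0 i != 0%R)]].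

(* [n, k]_q linear codes, non-trivial and of effective length n *)
Definition linear_code (k : nat) C : Prop :=
  [/\ 0 < k, \dim C = k & supp C = [set: 'I_n]].

Definition generator_matrix (k : nat) (G : 'M[F]_(k, n)) C : Prop :=
  basis_of C [tuple row i G | i < k].

(* Replacing G by another generator matrix acts on the columns by an element   *)
(* of GL_k(q), so this does not depend on the choice of G.                     *)
Definition projective_code (k : nat) C : Prop :=
  exists G : 'M[F]_(k, n),
    [/\ generator_matrix G C,
        forall j, col j G <> 0%R
      & injective (fun j => <[col j G]>%VS)].

Definition support_minimal C (l : nat) D : bool :=
  [&& (D <= C)%VS, \dim D == l
    & ~~ [exists D' : {vspace 'rV[F]_n},
           [&& (D' <= C)%VS, \dim D' == l & supp D' \proper supp D]]].

Definition num_support_minimal (l : nat) C : nat :=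
  #|[set D : {vspace 'rV[F]_n} | support_minimal C l D]|.

End Codes.

Section Alpha.

Variables (F : finFieldType) (k : nat).
Local Notation subspace := {vspace 'cV[F]_k}.

(* the points of PG(F^k) lying in W *)
Definition points (W : subspace) : {set subspace} :=
  [set P : subspace | (\dim P == 1) && (P <= W)%VS].

(* Codimensions are stated additively, so that a subspace of codimension      *)
(* greater than k does not exist.                                             *)
Definition has_codim (W : subspace) (c : nat) : bool := \dim W + c == k.

Definition contains_differences (l r : nat) (S : {set subspace}) : bool :=
  (S \subset points fullv) &&
  [exists W : {ffun 'I_r -> subspace}, exists U : {ffun 'I_r -> subspace},
    [&& injectiveb W,
        [forall i, has_codim (W i) l],
        [forall i, has_codim (U i) l.+1],
        [forall i, (U i <= W i)%VS]
      & \bigcup_(i < r) (points (W i) :\: points (U i)) \subset S]].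

(* alpha_q^l(k, r). Admissible sets are closed under enlargement inside        *)
(* PG(F^k), so the set of all points is admissible as soon as some set is. If  *)
(* none is (e.g. l = k, r = 1, as there is no subspace of codimension k + 1),  *)
(* the value is the total number of points.                                    *)
Definition alpha (l r : nat) : nat :=
  #|[arg min_(S < points fullv | contains_differences l r S) #|S|]|.

End Alpha.

(* Main.v *)
(* Via a generator matrix G, an l-dimensional subcode D of C corresponds to a
   subspace W_D of F^k of codimension l, namely the common kernel of the
   coordinate vectors of D, and column j of G lies in W_D exactly when j is
   outside supp D. If D is not support-minimal, the columns lying in W_D also
   lie in W_D' for some D' <> D of the same dimension, so they do not span W_D
   and are contained in a hyperplane U_D of W_D: no column is in W_D \ U_D.
   With r non-minimal subcodes, the union of the W_D \ U_D is an admissible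
   set in the definition of alpha which misses the n points given by the
   columns, so n + alpha <= [k 1]_q <= [k l]_q. The last inequality holds for
   l < k, and l = k is excluded because W_D has a hyperplane. *)

Require Import Defs.
From mathcomp Require Import all_boot all_algebra finfield.

Set Implicit Arguments.
Unset Strict Implicit.
Unset Printing Implicit Defensive.

Import GRing.Theory Num.Theory.

(* Writing [k l]_q as (q^k - 1) / (q - 1) times the quotients
   (q^(k-i) - 1) / (q^(l-i+1) - 1) for 1 <= i < l, each of these is >= 1. *)
Lemma gauss_binomial1_le q k l : 1 < q -> 1 <= l < k ->
  gauss_binomial q k 1 <= gauss_binomial q k l.
Proof.
move=> q1 /andP[l0 lk]; case: l l0 lk => // l _ lk; rewrite /gauss_binomial.
rewrite !big_ord1 big_ord_recl big_ord_recr !subn0 /= subSnn expn1.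
set A := q ^ k - 1; set B := \prod_(i < l) _; set D := \prod_(i < l) _.
have D0 : 0 < D.
  apply/prodn_gt0 => i; rewrite subn_gt0 -(exp1n (l.+1 - i)) ltn_exp2r //.
  by rewrite subn_gt0 ltnS ltnW.
have leDB : D <= B.
  apply: leq_prod => i _; apply/leq_sub2r; rewrite leq_pexp2l ?(ltnW q1) //.
  by rewrite /bump add1n -subSS leq_sub2r.
by rewrite -(divnMl D0) leq_div2r // mulnC leq_mul.
Qed.

(** * Counting subspaces over a finite field *)

Section Counting.

Variables (F : finFieldType) (m n : nat).
Local Notation vT := 'M[F]_(m, n).
Implicit Types U V : {vspace vT}.

(** Induction on [l]: a free tail [t] in [V] extends by any head in [V] outside its span, and there
    are q^dim V - q^l such heads. *)
Lemma card_free_tuples V l :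
  #|[set t : l.-tuple vT | free t && (<<t>> <= V)%VS]|
    = \prod_(i < l) (#|F| ^ \dim V - #|F| ^ i).
Proof.
elim: l => [|l IHl].
  rewrite big_ord0; apply/eqP/cards1P; exists [tuple].
  by apply/setP => t; rewrite !inE tuple0 nil_free span_nil sub0v eqxx.
rewrite big_ord_recr /= -IHl -[LHS]sum1_card.
pose tl (t : l.+1.-tuple vT) := [tuple of behead t].
rewrite (partition_big tl
  (fun t => t \in [set t : l.-tuple vT | free t && (<<t>> <= V)%VS])) /=.
  rewrite -sum_nat_const; apply: eq_bigr => t; rewrite inE => /andP[frt tV].
  have qE : #|F| ^ l = #|<<t>>%VS| by rewrite card_vspace (eqnP frt) size_tuple.
  rewrite sum1_card -card_vspace qE.
  have -> : #|V| - #|<<t>>%VS| = #|[set v in V | v \notin <<t>>%VS]|.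
    rewrite -(cardsE (mem V)) -(cardsE (mem <<t>>%VS)) -cardsDS; last first.
      by apply/subsetP => v; rewrite !inE; apply: (subvP tV).
    by apply: eq_card => v; rewrite !inE andbC.
  have inj_cons : injective (fun v => [tuple of v :: t]).
    by move=> u v /(congr1 val) [].
  rewrite -(card_imset _ inj_cons); apply: eq_card => s.
  rewrite unfold_in !inE.
  apply/andP/imsetP => [[/andP[frs sV] /eqP tl_s] | [v]].
    case/tupleP: s => v s in frs sV tl_s *.
    have {}tl_s : s = t by rewrite -tl_s; apply/val_inj.
    move: frs sV; rewrite tl_s /= free_cons span_cons subv_add.
    move=> /andP[vt _] /andP[vV _]; exists v; last exact/val_inj.
    by rewrite inE vt andbT.
  rewrite inE => /andP[vV vt] ->; split; last by apply/eqP/val_inj.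
  by rewrite /= free_cons vt frt span_cons subv_add tV -memvE vV.
move=> s; rewrite !inE; case/tupleP: s => v s.
rewrite free_cons span_cons subv_add.
by case/andP => /andP[_ ->] /andP[_ ->].
Qed.

(** Double counting: the free [l]-tuples of [V] are grouped by their span. A free [l]-tuple inside
    an [l]-dimensional [U] spans [U], so [card_free_tuples] also gives the size of each group. *)
Lemma card_subspaces V l :
  #|[set U : {vspace vT} | (U <= V)%VS && (\dim U == l)]|
    * \prod_(i < l) (#|F| ^ l - #|F| ^ i)
  = \prod_(i < l) (#|F| ^ \dim V - #|F| ^ i).
Proof.
rewrite -card_free_tuples -[RHS]sum1_card.
rewrite (partition_big (fun t : l.-tuple vT => <<t>>%VS)
  (fun U => U \in [set U : {vspace vT} | (U <= V)%VS && (\dim U == l)])) /=.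
  rewrite -sum_nat_const; apply: eq_bigr => U; rewrite inE => /andP[UV /eqP dU].
  rewrite -[X in #|F| ^ X]dU -card_free_tuples -[LHS]sum1_card.
  apply: eq_bigl => t; rewrite !inE.
  apply/andP/andP => [[frt tU] | [/andP[frt tV] /eqP <-]]; last first.
    by rewrite frt subvv.
  have tE : <<t>>%VS == U by rewrite eqEdim tU (eqnP frt) size_tuple dU leqnn.
  by rewrite frt (eqP tE) UV eqxx.
by move=> t; rewrite !inE => /andP[/eqnP-> ->]; rewrite size_tuple eqxx.
Qed.

Lemma card_subspaces_gauss V l : l <= \dim V ->
  #|[set U : {vspace vT} | (U <= V)%VS && (\dim U == l)]| =
    gauss_binomial #|F| (\dim V) l.
Proof.
move=> lV; have q0 : 0 < #|F| := ltnW (finNzRing_gt1 F).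
(* Applied to [\dim V] and to [l]: the powers q^i cancel, and what remains shows that the division
   in [gauss_binomial] is exact. *)
have factor k : l <= k -> \prod_(i < l) (#|F| ^ k - #|F| ^ i) =
    (\prod_(i < l) (#|F| ^ (k - i) - 1)) * \prod_(i < l) #|F| ^ i.
  move=> lk; rewrite -big_split; apply: eq_bigr => i _ /=.
  by rewrite mulnBl mul1n -expnD subnK // ltnW // (leq_trans _ lk).
have P0 : 0 < \prod_(i < l) #|F| ^ i.
  by apply/prodn_gt0 => i; rewrite expn_gt0 q0.
have D0 : 0 < \prod_(i < l) (#|F| ^ (l - i) - 1).
  apply/prodn_gt0 => i; rewrite subn_gt0 -(exp1n (l - i)) ltn_exp2r.
    exact: finNzRing_gt1.
  by rewrite subn_gt0.
have /eqP := card_subspaces V l.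
rewrite !factor // mulnA eqn_pmul2r // => /eqP.
by rewrite /gauss_binomial => <-; rewrite mulnK.
Qed.

End Counting.

(** * Hyperplanes of a subspace *)

Section Hyperplanes.

Variables (F : fieldType) (vT : vectType F).
Implicit Types U V W : {vspace vT}.

(** Dropping a line from a complement of [V] in [W] and adding [V] back loses exactly one
    dimension. *)
Lemma hyperplane_between V W : (V <= W)%VS -> \dim V < \dim W ->
  exists U, [/\ (V <= U)%VS, (U <= W)%VS & (\dim U).+1 = \dim W].
Proof.
move=> VW dVW; have dT : \dim V + \dim (W :\: V) = \dim W.
  by rewrite -(dimv_cap_compl W V) (capv_idPr VW).
set T := (W :\: V)%VS in dT; set w := vpick T.
have dw : \dim <[w]> = 1.
  rewrite dim_vline vpick0 -dimv_eq0 -lt0n.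
  by rewrite -(ltn_add2l (\dim V)) dT addn0 dVW.
have dTw : (\dim (T :\: <[w]>)).+1 = \dim T.
  by rewrite -(dimv_cap_compl T <[w]>) (capv_idPr _) ?dw // -memvE memv_pick.
have TV0 : (V :&: (T :\: <[w]>) = 0)%VS.
  by apply/eqP; rewrite -subv0 -(capv_diff W V) capvC capvS ?diffvSl.
exists (V + (T :\: <[w]>))%VS; split; first exact: addvSl.
  by rewrite subv_add VW (subv_trans (diffvSl _ _)) ?diffvSl.
by rewrite dimv_disjoint_sum // -addnS dTw.
Qed.

End Hyperplanes.

(** * The correspondence between subcodes and subspaces of F^k *)

Section Annihilator.

Variables (F : finFieldType) (n k : nat) (G : 'M[F]_(k, n)).
Implicit Types D : {vspace 'rV[F]_n}.

Definition basis_mx D : 'M[F]_(\dim D, n) :=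
  \matrix_(i < \dim D) ((vbasis D)`_i)%R.

(** For [D] inside the row space of [G], the rows are coefficients of a basis of [D] over the rows
    of [G]. *)
Definition coord_mx D := (basis_mx D *m pinvmx G)%R.

Lemma mul_col m p q (A : 'M[F]_(m, p)) (B : 'M[F]_(p, q)) j :
  (A *m col j B = col j (A *m B))%R.
Proof. by rewrite !colE mulmxA. Qed.

Definition annihilator D : {vspace 'cV[F]_k} :=
  lker (linfun (mulmx (coord_mx D))).

Lemma mem_annihilator D x : (x \in annihilator D) = (coord_mx D *m x == 0)%R.
Proof. by rewrite memv_ker lfunE. Qed.

Lemma mem_basis_mx D (v : 'rV_n) : v \in D -> (v <= basis_mx D)%MS.
Proof.
move=> /coord_vbasis->; apply: summx_sub => i _; apply: scalemx_sub.
have -> : ((vbasis D)`_i)%R = row i (basis_mx D) by rewrite rowK.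
by apply: row_sub.
Qed.

Lemma basis_mx_free D : row_free (basis_mx D).
Proof.
rewrite -kermx_eq0; apply/eqP/row_matrixP => i; rewrite row0.
have /freeP frD := basis_free (vbasisP D).
apply/rowP => j; rewrite [RHS]mxE.
apply: (frD (fun j => row i (kermx (basis_mx D)) ord0 j)).
transitivity (row i (kermx (basis_mx D)) *m basis_mx D)%R.
  by rewrite mulmx_sum_row; apply: eq_bigr => p _; rewrite rowK.
by apply/sub_kermxP/row_sub.
Qed.

Definition rowspace : {vspace 'rV[F]_n} := <<[tuple row i G | i < k]>>%VS.

Lemma mem_rowspace v : v \in rowspace -> (v <= G)%MS.
Proof.
move=> /coord_span ->; apply: summx_sub => i _; apply: scalemx_sub.
by rewrite nth_mktuple row_sub.
Qed.

Lemma coord_mxK D : (D <= rowspace)%VS -> (coord_mx D *m G = basis_mx D)%R.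
Proof.
move=> /subvP DG; apply/mulmxKpV/row_subP => i.
by rewrite rowK mem_rowspace // DG // vbasis_mem // mem_nth // size_tuple.
Qed.

Lemma dim_annihilator D : (D <= rowspace)%VS ->
  \dim (annihilator D) + \dim D = k.
Proof.
move=> DG.
pose f := linfun (mulmx (coord_mx D)) : 'Hom('cV[F]_k, 'cV[F]_(\dim D)).
have limgf : (limg f = fullv)%VS.
  apply/eqP; rewrite eqEsubv subvf.
  (* As [coord_mx D *m G] is the row-free [basis_mx D], the matrix [G *m pinvmx (basis_mx D)] is a
     right inverse of [coord_mx D]. *)
  apply/subvP => y _; apply/memv_imgP; exists (G *m pinvmx (basis_mx D) *m y)%R.
    exact: memvf.
  rewrite lfunE /= -mulmxA [RHS]mulmxA coord_mxK //.
  by rewrite [RHS]mulmxA mulmxVp ?mul1mx // basis_mx_free.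
have := limg_ker_dim f fullv; rewrite limgf capfv !dimvf.
by rewrite /dim /= !muln1.
Qed.

(** The columns of the cokernel of [coord_mx D'] lie in [annihilator D'], so [coord_mx D] kills them
    and its rows are combinations of those of [coord_mx D']; multiplying by [G] returns to the
    code. *)
Lemma annihilatorS D D' : (D <= rowspace)%VS -> (D' <= rowspace)%VS ->
  (annihilator D' <= annihilator D)%VS -> (D <= D')%VS.
Proof.
move=> DG D'G /subvP sW; apply/subvP => v /mem_basis_mx vD.
have : (coord_mx D <= coord_mx D')%MS.
  rewrite submxE; apply/eqP/matrixP => i j.
  have /sW : col j (cokermx (coord_mx D')) \in annihilator D'.
    by rewrite mem_annihilator mul_col mulmx_coker col0.
  rewrite mem_annihilator mul_col => /eqP /colP/(_ i).
  by rewrite !mxE.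
move/(submxMr G); rewrite !coord_mxK // => /(submx_trans vD)/submxP[u ->].
rewrite mulmx_sum_row; apply: rpred_sum => i _; apply: rpredZ.
by rewrite rowK vbasis_mem // mem_nth // size_tuple.
Qed.

(** [coord_mx D] maps column [j] of [G] to column [j] of [basis_mx D]. *)
Lemma col_annihilator D j : (D <= rowspace)%VS ->
  (col j G \in annihilator D) = (j \notin supp D).
Proof.
move=> DG; rewrite mem_annihilator mul_col coord_mxK // inE.
apply/eqP/idP => [colj | /existsPn nzj].
  apply/existsPn => v; apply/negP => /andP[/mem_basis_mx/submxP[u ->]].
  have -> : (u *m basis_mx D)%R ord0 j = (u *m col j (basis_mx D))%R ord0 ord0.
    by rewrite mul_col [RHS]mxE.
  by rewrite colj mulmx0 mxE eqxx.
apply/colP => i; rewrite !mxE; apply/eqP; have := nzj ((vbasis D)`_i)%R.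
by rewrite vbasis_mem ?mem_nth ?size_tuple // negbK.
Qed.

End Annihilator.

(** * Non-minimal subcodes and admissible point sets *)

Lemma nonminimal_hyperplane (F : finFieldType) (n k : nat) (G : 'M[F]_(k, n))
    (D D' : {vspace 'rV[F]_n}) :
    (D <= rowspace G)%VS -> (D' <= rowspace G)%VS -> \dim D = \dim D' ->
    supp D' \proper supp D ->
  exists U : {vspace 'cV[F]_k},
    [/\ (U <= annihilator G D)%VS, (\dim U).+1 = \dim (annihilator G D)
      & forall j, col j G \in annihilator G D -> col j G \in U].
Proof.
move=> DG D'G dimDD' /properP[sD'D [j0 j0D j0D']].
pose W := annihilator G D; pose W' := annihilator G D'.
pose V := (\sum_(j | col j G \in W) <[col j G]>)%VS.
have VW : (V <= W)%VS by apply/subv_sumP => j; rewrite memvE.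
have VW' : (V <= W')%VS.
  apply/subv_sumP => j; rewrite -memvE !col_annihilator //.
  by apply: contra => /(subsetP sD'D).
have dimWW' : \dim W = \dim W'.
  by apply/eqP; rewrite -(eqn_add2r (\dim D)) {2}dimDD' !dim_annihilator.
have dVW : \dim V < \dim W.
  (* Otherwise [W] lies in [W'] and equals it by dimension, but column [j0] is in [W'] and not in
     [W]. *)
  rewrite (ltn_leqif (dimv_leqif_sup VW)); apply/negP => WV.
  have /eqP WW' : W == W' by rewrite eqEdim (subv_trans WV VW') dimWW' leqnn.
  have := col_annihilator j0 D'G; rewrite -/W' -WW' col_annihilator //.
  by rewrite j0D j0D'.
have [U [VU UW dU]] := hyperplane_between VW dVW.
exists U; split=> // j jW; apply: (subvP VU); rewrite memvE.
exact: (sumv_sup j).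
Qed.

(** The minimum is meaningful once the default, the set of all points, is admissible; the [W] and
    [U] witnessing [S] show that it is. *)
Lemma alpha_min (F : finFieldType) (k l r : nat) (S : {set {vspace 'cV[F]_k}}) :
  contains_differences l r S -> alpha F k l r <= #|S|.
Proof.
move=> hS; rewrite /alpha; case: arg_minnP => [|T _ minT]; last exact: minT.
case/andP: hS => _ /existsP[W /existsP[U /and5P[iW dW dU UW _]]].
rewrite /contains_differences subxx; apply/existsP; exists W.
apply/existsP; exists U; rewrite iW dW dU UW /=; apply/bigcupsP => i _.
apply/subsetP => P; rewrite !inE => /andP[_ /andP[-> _]]; exact: subvf.
Qed.

(** * Counting the columns outside an admissible set *)

Theorem proposition4p2 (F : finFieldType) (n k l r : nat)
    (C : {vspace 'rV[F]_n})
    (hC : linear_code k C) (hproj : projective_code k C)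
    (hl : 1 <= l <= k) (hr : 1 <= r <= gauss_binomial #|F| k l)
    (hn : ((gauss_binomial #|F| k l)%:Z - (alpha F k l r)%:Z < n%:Z)%R) :
  ((gauss_binomial #|F| k l)%:Z - r%:Z < (num_support_minimal l C)%:Z)%R.
Proof.
have [_ dimC _] := hC; have [G [genG nzG injG]] := hproj.
have GC : rowspace G = C := span_basis genG.
have [/andP[l0 lk] /andP[r0 _]] := (hl, hr).
move: hn; rewrite !ltrBlDr -!PoszD !ltz_nat => {}hn.
rewrite ltnNge; apply/negP => few.
pose subcodes := [set D : {vspace 'rV[F]_n} | (D <= C)%VS && (\dim D == l)].
pose nonmin := subcodes :\: [set D | support_minimal C l D].
have cardN : r <= #|nonmin|.
  have := cardsID [set D | support_minimal C l D] subcodes.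
  rewrite card_subspaces_gauss dimC // (setIidPr _).
    by move=> cardE; move: few; rewrite /num_support_minimal -cardE leq_add2l.
  by apply/subsetP => D; rewrite !inE => /and3P[-> ->].
(* The boolean form allows [xchoose] to select one hyperplane per subcode. *)
have nonminP D : D \in nonmin -> exists U : {vspace 'cV[F]_k},
    [&& (U <= annihilator G D)%VS, (\dim U).+1 == \dim (annihilator G D)
      & [forall j, (col j G \in annihilator G D) ==> (col j G \in U)]].
  rewrite !inE => /andP[+ /andP[DC dD]].
  rewrite /support_minimal DC dD negbK /= => /existsP[D' /and3P[D'C dD' sD]].
  rewrite -GC in DC D'C; have dDD' : \dim D = \dim D'.
    by rewrite (eqP dD) (eqP dD').
  have [U [UW dU GU]] := nonminimal_hyperplane DC D'C dDD' sD.
  exists U; rewrite UW dU eqxx; apply/forallP => j; exact/implyP/GU.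
(* The first [r] non-minimal subcodes in enumeration order, hence pairwise distinct. *)
pose Dof (i : 'I_r) := enum_val (widen_ord cardN i).
have DofN i : Dof i \in nonmin by exact: enum_valP.
have DofC i : (Dof i <= rowspace G)%VS.
  by have := DofN i; rewrite GC !inE => /and3P[].
have dimD i : \dim (Dof i) = l.
  by have := DofN i; rewrite !inE => /and3P[_ _ /eqP].
pose W := [ffun i => annihilator G (Dof i)].
pose U := [ffun i => xchoose (nonminP _ (DofN i))].
have UP i : [&& (U i <= W i)%VS, (\dim (U i)).+1 == \dim (W i)
      & [forall j, (col j G \in W i) ==> (col j G \in U i)]].
  by rewrite !ffunE; apply: (xchooseP (nonminP _ (DofN i))).
have dimW i : \dim (W i) + l = k by rewrite ffunE -(dimD i) dim_annihilator.
have ltlk : l < k.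
  rewrite -(dimW (Ordinal r0)) -[X in X < _]add0n ltn_add2r.
  by have /and3P[_ /eqP <- _] := UP (Ordinal r0).
pose S := \bigcup_(i < r) (points (W i) :\: points (U i)).
have Spoints : S \subset points fullv.
  apply/bigcupsP => i _; apply/subsetP => P.
  by rewrite !inE subvf andbT => /andP[_ /andP[]].
have leS : alpha F k l r <= #|S|.
  apply: alpha_min; rewrite /contains_differences Spoints.
  apply/existsP; exists W; apply/existsP; exists U; apply/and5P; split=> //.
  - apply/injectiveP => i j; rewrite !ffunE => eqW.
    suff /(congr1 val) eqij : widen_ord cardN i = widen_ord cardN j.
      exact: val_inj.
    (* Equal annihilators give both inclusions between the two subcodes. *)
    apply: enum_val_inj; apply/eqP; rewrite eqEsubv.
    by rewrite !(annihilatorS (DofC _) (DofC _)) // eqW subvv.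
  - by apply/forallP => i; rewrite /has_codim dimW.
  - apply/forallP => i; rewrite /has_codim addnS -addSn.
    by have /and3P[_ /eqP-> _] := UP i; rewrite dimW.
  - by apply/forallP => i; have /and3P[] := UP i.
(* Projectivity makes these [n] distinct points. *)
pose P := [set <[col j G]>%VS | j : 'I_n].
have cardP : #|P| = n by rewrite card_imset ?card_ord.
have PS : P \subset points fullv :\: S.
  apply/subsetP => _ /imsetP[j _ ->]; rewrite !inE subvf andbT dim_vline.
  have -> : col j G != 0%R by apply/eqP/nzG.
  rewrite andbT; apply/bigcupP => -[i _]; rewrite !inE -!memvE.
  (* By the choice of [U i], a column in [W i] already lies in [U i]. *)
  case/andP=> /negP jU /andP[d1 jW]; case: jU; rewrite d1 /=.
  by have /and3P[_ _ /forallP/(_ j)] := UP i; rewrite jW.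
have leN : n <= #|points fullv :\: S|.
  by rewrite -[n in n <= _]cardP; apply: subset_leq_card PS.
have: n + alpha F k l r <= gauss_binomial #|F| k l.
  apply: leq_trans (leq_add leN leS) _.
  rewrite -{2}(setIidPr Spoints) addnC.
  rewrite cardsID; apply: leq_trans (_ : gauss_binomial #|F| k 1 <= _).
    (* Points are the one-dimensional subspaces of F^k. *)
    have := @card_subspaces_gauss F k 1 fullv 1.
    rewrite dimvf /dim /= muln1 => <-; last exact: leq_trans l0 lk.
    by apply/eq_leq/eq_card => Q; rewrite !inE andbC.
  by apply: gauss_binomial1_le; rewrite ?finNzRing_gt1 ?l0.
by rewrite leqNgt hn.
Qed.
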